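(* Let $G$ be a finite group, let $*$ be a nonidentical involutory antiautomorphism of $G$ with $gg^*\in Z(G)$ for every $g\in G$, and let $g_0\in Z(G)$ with $g_0^*=g_0$. Let $\beta\in\{xy,\,x^*y,\,yx,\,yx^*\}$, $\gamma\in\{xy,\,yx\}$ and $\delta\in\{g_0xy,\,g_0xy^*,\,g_0x^*y,\,g_0x^*y^*,\,g_0yx,\,g_0yx^*,\,g_0y^*x,\,g_0y^*x^*\}$. Then the loop $L=Q(G,*,g_0,\beta,\gamma,\delta)$ is a left nuclear square loop if and only if at least one of the following holds: (a) $L$ is an LC-loop; (b) $(\beta,\gamma,\delta)$ is among $(xy,xy,g_0xy^* )$, $(yx^*,yx,g_0x^*y)$, $(yx^*,yx,g_0x^*y^* )$; (c) $G/Z(G)$ is an elementary abelian $2$-group and $(\beta,\gamma,\delta)$ is among $(xy,xy,g_0yx)$, $(xy,xy,g_0y^*x)$, $(xy,yx,g_0xy)$, $(xy,yx,g_0xy^* )$, $(xy,yx,g_0y^*x)$, $(x^*y,xy,g_0x^*y^* )$, $(x^*y,xy,g_0yx^* )$, $(x^*y,xy,g_0y^*x^* )$, $(x^*y,yx,g_0x^*y)$, $(x^*y,yx,g_0x^*y^* )$, $(x^*y,yx,g_0y^*x^* )$, $(yx,xy,g_0xy^* )$, $(yx,xy,g_0yx)$, $(yx,xy,g_0y^*x)$, $(yx,yx,g_0xy)$, $(yx,yx,g_0xy^* )$, $(yx,yx,g_0y^*x)$, $(yx^*,xy,g_0x^*y^* )$, $(yx^*,xy,g_0yx^* )$, $(yx^*,xy,g_0y^*x^*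 )$, $(yx^*,yx,g_0y^*x^* )$; (d) $G/Z(G)$ is an elementary abelian $2$-group, $(xx)^*=xx$ for every $x\in G$, and $(\beta,\gamma,\delta)$ is among $(xy,xy,g_0x^*y^* )$, $(xy,xy,g_0yx^* )$, $(xy,xy,g_0y^*x^* )$, $(xy,yx,g_0x^*y)$, $(xy,yx,g_0x^*y^* )$, $(xy,yx,g_0y^*x^* )$, $(x^*y,xy,g_0xy^* )$, $(x^*y,xy,g_0yx)$, $(x^*y,xy,g_0y^*x)$, $(x^*y,yx,g_0xy)$, $(x^*y,yx,g_0xy^* )$, $(x^*y,yx,g_0y^*x)$, $(yx,xy,g_0x^*y^* )$, $(yx,xy,g_0yx^* )$, $(yx,xy,g_0y^*x^* )$, $(yx,yx,g_0x^*y)$, $(yx,yx,g_0x^*y^* )$, $(yx,yx,g_0y^*x^* )$, $(yx^*,xy,g_0xy^* )$, $(yx^*,xy,g_0yx)$, $(yx^*,xy,g_0y^*x)$, $(yx^*,yx,g_0xy)$, $(yx^*,yx,g_0xy^* )$, $(yx^*,yx,g_0y^*x)$.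
   Context: $Z(G)$ is the center of $G$. An involutory antiautomorphism $*$ of $G$ satisfies $(g^* )^*=g$ and $(gh)^*=h^*g^*$; nonidentical means $g^*\neq g$ for some $g\in G$. A word such as $yx^*$ or $g_0y^*x$ denotes the function $G\times G\to G$ sending $(x,y)$ to the value of the word. Words are regarded as functions: two words are identified when they define the same function on $G\times G$ (for instance $xy$ and $yx$ when $G$ is commutative), and equality of triples $(\beta,\gamma,\delta)$ means equality of the three functions. Let $Gu=\{gu : g\in G\}$ be a disjoint copy of $G$. The loop $Q(G,*,g_0,\beta,\gamma,\delta)$ is the set $G\cup Gu$ with the multiplication, for $x,y\in G$, $$x\circ y=xy,\quad x\circ yu=\beta(x,y)u,\quad xu\circ y=\gamma(x,y)u,\quad xu\circ yu=\delta(x,y).$$ It is a loop with neutral element $1\in G$. The trivial group counts as an elementary abelian $2$-group. A loop is a left nuclear square loop if it satisfies $(xx)(yz)=((xx)y)z$, and an LC-loop if it satisfies $(xx)(yz)=(x(xy))z$. *)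

(* Defs.v *)
From mathcomp Require Import all_boot all_fingroup all_solvable.

Set Implicit Arguments.
Unset Strict Implicit.
Unset Printing Implicit Defensive.

Local Open Scope group_scope.

Section Loops.

Variables (T : Type) (op : T -> T -> T) (e : T).

Definition is_loop : Prop :=
  [/\ left_id e op, right_id e op,
      forall a, bijective (fun x => op a x)
    & forall a, bijective (fun x => op x a)].

Definition left_nuclear_square_loop : Prop :=
  is_loop /\ forall x y z, op (op x x) (op y z) = op (op (op x x) y) z.

Definition LC_loop : Prop :=
  is_loop /\ forall x y z, op (op x x) (op y z) = op (op x (op x y)) z.

End Loops.

Definition involutory_antiautomorphism (gT : finGroupType) (star : gT -> gT) :
  Prop :=
  involutive star /\ {morph star : x y / x * y >-> y * x}.

(* A word in x, y is the function (x, y) |-> value.  On finite functions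
   Leibniz equality is extensional, so that words defining the same function
   on G x G are identified. *)
Definition word (gT : finGroupType) := {ffun gT * gT -> gT}.

Section Words.

Variables (gT : finGroupType) (star : gT -> gT) (g0 : gT).

(* The letter s marks the application of star to the variable preceding it. *)
Definition w_xy   : word gT := [ffun p => p.1 * p.2].
Definition w_xys  : word gT := [ffun p => p.1 * star p.2].
Definition w_xsy  : word gT := [ffun p => star p.1 * p.2].
Definition w_xsys : word gT := [ffun p => star p.1 * star p.2].
Definition w_yx   : word gT := [ffun p => p.2 * p.1].
Definition w_yxs  : word gT := [ffun p => p.2 * star p.1].
Definition w_ysx  : word gT := [ffun p => star p.2 * p.1].
Definition w_ysxs : word gT := [ffun p => star p.2 * star p.1].

Definition w_scale (w : word gT) : word gT := [ffun p => g0 * w p].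

Local Notation "'g0*' w" := (w_scale w) (at level 10, w at level 9).

Definition beta_words : seq (word gT) := [:: w_xy; w_xsy; w_yx; w_yxs].

Definition gamma_words : seq (word gT) := [:: w_xy; w_yx].

Definition delta_words : seq (word gT) :=
  [:: g0* w_xy; g0* w_xys; g0* w_xsy; g0* w_xsys;
      g0* w_yx; g0* w_yxs; g0* w_ysx; g0* w_ysxs].

Definition triples_b : seq (word gT * word gT * word gT) :=
  [:: (w_xy, w_xy, g0* w_xys); (w_yxs, w_yx, g0* w_xsy);
      (w_yxs, w_yx, g0* w_xsys)].

Definition triples_c : seq (word gT * word gT * word gT) :=
  [:: (w_xy, w_xy, g0* w_yx);     (w_xy, w_xy, g0* w_ysx);
      (w_xy, w_yx, g0* w_xy);     (w_xy, w_yx, g0* w_xys);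
      (w_xy, w_yx, g0* w_ysx);    (w_xsy, w_xy, g0* w_xsys);
      (w_xsy, w_xy, g0* w_yxs);   (w_xsy, w_xy, g0* w_ysxs);
      (w_xsy, w_yx, g0* w_xsy);   (w_xsy, w_yx, g0* w_xsys);
      (w_xsy, w_yx, g0* w_ysxs);  (w_yx, w_xy, g0* w_xys);
      (w_yx, w_xy, g0* w_yx);     (w_yx, w_xy, g0* w_ysx);
      (w_yx, w_yx, g0* w_xy);     (w_yx, w_yx, g0* w_xys);
      (w_yx, w_yx, g0* w_ysx);    (w_yxs, w_xy, g0* w_xsys);
      (w_yxs, w_xy, g0* w_yxs);   (w_yxs, w_xy, g0* w_ysxs);
      (w_yxs, w_yx, g0* w_ysxs)].

Definition triples_d : seq (word gT * word gT * word gT) :=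
  [:: (w_xy, w_xy, g0* w_xsys);   (w_xy, w_xy, g0* w_yxs);
      (w_xy, w_xy, g0* w_ysxs);   (w_xy, w_yx, g0* w_xsy);
      (w_xy, w_yx, g0* w_xsys);   (w_xy, w_yx, g0* w_ysxs);
      (w_xsy, w_xy, g0* w_xys);   (w_xsy, w_xy, g0* w_yx);
      (w_xsy, w_xy, g0* w_ysx);   (w_xsy, w_yx, g0* w_xy);
      (w_xsy, w_yx, g0* w_xys);   (w_xsy, w_yx, g0* w_ysx);
      (w_yx, w_xy, g0* w_xsys);   (w_yx, w_xy, g0* w_yxs);
      (w_yx, w_xy, g0* w_ysxs);   (w_yx, w_yx, g0* w_xsy);
      (w_yx, w_yx, g0* w_xsys);   (w_yx, w_yx, g0* w_ysxs);
      (w_yxs, w_xy, g0* w_xys);   (w_yxs, w_xy, g0* w_yx);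
      (w_yxs, w_xy, g0* w_ysx);   (w_yxs, w_yx, g0* w_xy);
      (w_yxs, w_yx, g0* w_xys);   (w_yxs, w_yx, g0* w_ysx)].

End Words.

(* The carrier of Q is G + G: inl x stands for x and inr x for xu.
   star and g0 enter the product only through beta, gamma and delta. *)
Definition Qmul (gT : finGroupType) (beta gamma delta : word gT)
    (a b : gT + gT) : gT + gT :=
  match a, b with
  | inl x, inl y => inl (x * y)
  | inl x, inr y => inr (beta (x, y))
  | inr x, inl y => inr (gamma (x, y))
  | inr x, inr y => inl (delta (x, y))
  end.

Definition Qone (gT : finGroupType) : gT + gT := inl 1.

(* Main.v *)
Require Import Defs.
From mathcomp Require Import all_boot all_fingroup all_solvable.

(** Every square of L lies in G, and for a central s of G multiplication by s
    in L is multiplication by s or by s^* in G.  Hence, when the squares of G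
    are central, L is a left nuclear square loop as soon as either beta and
    delta star their first argument alike or all the squares are fixed by *.
    Conversely, evaluating the identity at y, z in {1, u} and at one free
    variable forces both conditions, except for four triples, which satisfy the
    identity in every G.  An LC-loop is a left nuclear square loop with the
    left alternative law, which the identity implies when gamma and delta
    multiply in the same order and delta does not star y. *)

Local Open Scope group_scope.

Section LoopsOfWords.

Variables (gT : finGroupType) (star : gT -> gT) (g0 : gT).

(** * Words coded by Booleans *)

Definition starb (a : bool) (x : gT) : gT := if a then star x else x.

Definition mulb (c : bool) (x y : gT) : gT := if c then y * x else x * y.

(* [a] and [b] say whether x and y are starred, [c] whether they are swapped. *)
Definition bword (a b c : bool) : word gT :=
  [ffun p => mulb c (starb a p.1) (starb b p.2)].

(** The product of equations serves as one rewrite rule that turns the listed triples into Boolean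
    codes, so that membership can be settled by case analysis. *)
Lemma bwordE :
  (w_xy gT = bword false false false) * (w_xys star = bword false true false) *
  (w_xsy star = bword true false false) *
  (w_xsys star = bword true true false) *
  (w_yx gT = bword false false true) * (w_yxs star = bword true false true) *
  (w_ysx star = bword false true true) * (w_ysxs star = bword true true true).
Proof. by []. Qed.

Lemma beta_wordsP (beta : word gT) :
  beta \in beta_words star -> exists a c, beta = bword a false c.
Proof.
rewrite !inE => /or4P[] /eqP->;
  [exists false, false | exists true, false | exists false, true
  | exists true, true]; exact: erefl.
Qed.

Lemma gamma_wordsP (gamma : word gT) :
  gamma \in gamma_words gT -> exists c, gamma = bword false false c.
Proof.
by rewrite !inE => /orP[] /eqP->; [exists false | exists true].
Qed.

Lemma delta_wordsP (delta : word gT) :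
  delta \in delta_words star g0 ->
  exists a b c, delta = w_scale g0 (bword a b c).
Proof.
rewrite !inE => /or4P[/eqP->|/eqP->|/eqP->|/or4P[/eqP->|/eqP->|/eqP->|]].
- by exists false, false, false.
- by exists false, true, false.
- by exists true, false, false.
- by exists true, true, false.
- by exists false, false, true.
- by exists true, false, true.
by case/orP=> /eqP->; [exists false, true, true | exists true, true, true].
Qed.

(** * The center and its quotient *)

Lemma in_centerTP (s : gT) :
  reflect (forall y, s * y = y * s) (s \in 'Z([set: gT])).
Proof.
apply: (iffP (centerP _ _)) => [[_ sC] y | sC]; first exact: sC (in_setT y).
by split=> [|y _]; [apply: in_setT | apply: sC].
Qed.

(** Exponent 2 already makes the quotient abelian: X Y = (X Y)^-1 = Y^-1 X^-1 = Y X. *)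
Lemma abelem_center_quotient :
  2.-abelem ([set: gT] / 'Z([set: gT])) <->
  forall x : gT, x * x \in 'Z([set: gT]).
Proof.
have nZ x : x \in 'N('Z([set: gT])).
  by apply: (subsetP (normal_norm (center_normal _))); apply: in_setT.
have sqE x : coset 'Z([set: gT]) x ^+ 2 = coset 'Z([set: gT]) (x * x).
  by rewrite expgS expg1 morphM ?nZ.
split=> [/(abelemP (isT : prime 2))[_ sq1] x | sqZ].
  apply: coset_idr (nZ _) _; rewrite -sqE; apply: sq1.
  by apply: mem_quotient; apply: in_setT.
have sq1 X : X \in [set: gT] / 'Z([set: gT]) -> X ^+ 2 = 1.
  by case/morphimP=> x _ _ ->; rewrite sqE; apply: coset_id.
apply/(abelemP (isT : prime 2)); split=> //.
apply/centsP=> X HX Y HY; rewrite /commute.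
have inv Z : Z \in [set: gT] / 'Z([set: gT]) -> Z^-1 = Z.
  by move/sq1/eqP; rewrite expgS expg1 -eq_invg_mul => /eqP.
by rewrite -{1}(inv _ (groupM HX HY)) invMg !inv.
Qed.

Hypothesis star_anti : involutory_antiautomorphism star.
Hypothesis star_norm : forall g : gT, g * star g \in 'Z([set: gT]).
Hypothesis g0_center : g0 \in 'Z([set: gT]).
Hypothesis g0_star : star g0 = g0.

Let starK : involutive star. Proof. by case: star_anti. Qed.

Let starM x y : star (x * y) = star y * star x.
Proof. by case: star_anti. Qed.

Let star_inj : injective star. Proof. exact: inv_inj starK. Qed.

Let g0C y : g0 * y = y * g0. Proof. exact/in_centerTP. Qed.

(** * Calculation with optional stars and swaps *)

Lemma star1 : star 1 = 1.
Proof. by apply: (mulgI (star 1)); rewrite -starM !mulg1. Qed.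

Lemma starb1 (a : bool) : starb a 1 = 1.
Proof. by case: a => //; apply: star1. Qed.

Lemma starb_inj (a : bool) : injective (starb a).
Proof. by case: a => // x y /star_inj. Qed.

Lemma starb_addb (a b : bool) x : starb a (starb b x) = starb (a (+) b) x.
Proof. by case: a b => [] [] //=; apply: starK. Qed.

Lemma starb_center a s :
  s \in 'Z([set: gT]) -> starb a s \in 'Z([set: gT]).
Proof.
case: a => //= /in_centerTP sC; apply/in_centerTP=> y.
by apply: star_inj; rewrite !starM starK sC.
Qed.

Lemma starbMl a s y :
  s \in 'Z([set: gT]) -> starb a (s * y) = starb a s * starb a y.
Proof.
by case: a => //= /(starb_center true)/in_centerTP sC; rewrite starM -sC.
Qed.

Lemma mulb1 c x : mulb c x 1 = x.
Proof. by case: c; rewrite /= ?mulg1 ?mul1g. Qed.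

Lemma mul1b c x : mulb c 1 x = x.
Proof. by case: c; rewrite /= ?mulg1 ?mul1g. Qed.

Lemma mulbI c x : injective (mulb c x).
Proof. by case: c => y z; [apply: mulIg | apply: mulgI]. Qed.

Lemma mulIb c x : injective (mulb c ^~ x).
Proof. by case: c => y z; [apply: mulgI | apply: mulIg]. Qed.

Lemma mulb_center c s y : s \in 'Z([set: gT]) -> mulb c s y = s * y.
Proof. by case: c => //= /in_centerTP sC; rewrite sC. Qed.

Lemma mulbMl c s x y :
  s \in 'Z([set: gT]) -> mulb c (s * x) y = s * mulb c x y.
Proof. by case: c => /= /in_centerTP sC; rewrite !mulgA // -sC. Qed.

(** As [x * star x] is central, it commutes with [x]; cancel [x] on the left. *)
Lemma starC x : star x * x = x * star x.
Proof.
have /in_centerTP nC := star_norm x.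
by apply: (mulgI x); rewrite mulgA nC.
Qed.

(** * The loop of a coded triple *)

Section Triple.

Variables (a cb cg d1 d2 cd : bool).

Let Q := Qmul (bword a false cb) (bword false false cg)
              (w_scale g0 (bword d1 d2 cd)).

(** The carrier is finite, so injective translations are bijective. *)
Lemma Q_is_loop : is_loop Q (Qone gT).
Proof.
split.
- by case=> y /=; rewrite ?ffunE /= ?starb1 ?mul1b ?mul1g.
- by case=> x /=; rewrite ?ffunE /= ?starb1 ?mulb1 ?mulg1.
- case=> x; apply: injF_bij; case=> y; case=> z //=; rewrite ?ffunE /= => -[].
  + by move/mulgI->.
  + by move/mulbI->.
  + by move/mulbI->.
  by move/mulgI/mulbI/starb_inj->.
case=> x; apply: injF_bij; case=> y; case=> z //=; rewrite ?ffunE /= => -[].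
- by move/mulIg->.
- by move/mulIb->.
- by move/mulIb/starb_inj->.
by move/mulgI/mulIb/starb_inj->.
Qed.

(** Setting z = 1 in the LC identity yields the left alternative law, which exchanges the two
    right-hand sides. *)
Lemma LC_loopP :
  LC_loop Q (Qone gT) <->
  left_nuclear_square_loop Q (Qone gT) /\
  (forall x y, Q (Q x x) y = Q x (Q x y)).
Proof.
have [_ id1 _ _] := Q_is_loop.
split=> [[_ LC] | [[_ LNS] LA]]; last first.
  by split=> [|x y z]; [apply: Q_is_loop | rewrite LNS LA].
have LA x y : Q (Q x x) y = Q x (Q x y).
  by have := LC x y (Qone gT); rewrite !id1.
by split=> //; split=> [|x y z]; [apply: Q_is_loop | rewrite LC LA].
Qed.

(** A central [s] acts on Gu as multiplication by [starb a s]. Pulling this factor out of the first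
    argument of delta stars it [d1] times more, so only the product of two elements of Gu needs the
    second hypothesis. *)
Lemma central_left_nuclear s y z :
    s \in 'Z([set: gT]) -> starb (d1 (+) a) s = s ->
  Q (inl s) (Q y z) = Q (Q (inl s) y) z.
Proof.
move=> sZ s_fix; have asZ := starb_center a _ sZ.
have dasZ := starb_center d1 _ asZ.
have mul_as c v := mulb_center c _ v asZ.
have mulM_as c u v := mulbMl c _ u v asZ.
case: y z => y [] z /=; rewrite ?ffunE /= ?mulgA //; congr (_ _).
- by rewrite mul_as starbMl // mulM_as.
- by rewrite !mul_as mulM_as.
by rewrite mul_as starbMl // mulbMl // starb_addb s_fix !mulgA g0C.
Qed.

Lemma left_nuclear_square_of_central_squares :
    (forall x : gT, x * x \in 'Z([set: gT])) ->
    a = d1 \/ (forall x : gT, star (x * x) = x * x) ->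
  left_nuclear_square_loop Q (Qone gT).
Proof.
move=> sqZ sqfix; split=> [|x y z]; first exact: Q_is_loop.
have fix_of s : (forall x : gT, star (x * x) = x * x) -> star s = s ->
    starb (d1 (+) a) s = s by case: (_ (+) _).
case: x => x /=; apply: central_left_nuclear => //.
- by case: sqfix => [-> | sqfix]; [rewrite addbb | apply: fix_of].
- rewrite !ffunE /= groupM //.
  (* Up to the factor [g0], the square of xu is [x * x], its star, or [x * star x]. *)
  by case: d1 d2 cd => [] [] []; rewrite /= -?starM ?starC //;
     apply: (starb_center true).
rewrite !ffunE /=; case: sqfix => [-> | sqfix]; first by rewrite addbb.
apply: fix_of => //; rewrite starM g0_star -g0C; congr (_ * _).
by case: d1 d2 cd => [] [] []; rewrite /= ?starM ?starK // -?starM ?sqfix //.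
Qed.

(** This is the identity at y = z = u, where u is [inr 1]. For [d1] different from [a] it says that
    * fixes all squares. *)
Lemma left_nuclear_square_starb :
    left_nuclear_square_loop Q (Qone gT) ->
  forall x : gT, starb (d1 (+) a) (x * x) = x * x.
Proof.
case=> _ LNS x; have /= := LNS (inl x) (inr 1) (inr 1).
rewrite !ffunE /= !starb1 !mulb1 starb_addb mulg1 => -[].
by rewrite -g0C => /mulgI.
Qed.

Lemma left_nuclear_square_central_squares :
    left_nuclear_square_loop Q (Qone gT) ->
    ~~ [&& a == cb, cg == cb, d1 == a & ~~ cd] ->
  forall x : gT, x * x \in 'Z([set: gT]).
Proof.
move=> LNS nexc x.
have sfix := left_nuclear_square_starb LNS x.
case: LNS => _ /(_ (inl x)) /=; move: (x * x) sfix => s sfix LNS.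
have starbZ b : starb b s \in 'Z([set: gT]) -> s \in 'Z([set: gT]).
  by move/(starb_center b); rewrite starb_addb addbb.
have E2 y : mulb cb (starb a s) (starb a y) = starb a (s * y).
  have := LNS (inl y) (inr 1).
  by rewrite /= !ffunE /= !mulb1 => -[].
have E3 z : mulb cb (starb a s) z = mulb cg (starb a s) z.
  have := LNS (inr 1) (inl z).
  by rewrite /= !ffunE /= mul1b mulb1 => -[].
have g0I u v : s * (g0 * u) = g0 * v -> s * u = v.
  by rewrite mulgA -g0C -mulgA => /mulgI.
have E4 z : s * starb d2 z = mulb cd s (starb d2 z).
  have := LNS (inr 1) (inr z).
  by rewrite /= !ffunE /= mulb1 starb1 mul1b starb_addb sfix => -[] /g0I.
have E5 y : s * starb d1 y = starb d1 (mulb cb (starb a s) y).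
  have := LNS (inr y) (inr 1).
  by rewrite /= !ffunE /= !starb1 !mulb1 => -[] /g0I.
have starb2 b y : starb b (starb b y) = y by rewrite starb_addb addbb.
(* Each failing conjunct makes the two sides of one equation multiply in opposite orders, once stars
   are cancelled: [a == cb] in [E2], [cg == cb] in [E3], [d1 == a] in [E5], [~~ cd] in [E4]. So
   [starb a s] or [s] is central. *)
have [eq_acb | neq] := eqVneq a cb; last first.
  apply: (starbZ a); apply/in_centerTP=> y.
  have := E2 (starb a y); rewrite starb2.
  by case: a cb neq => [] [] //= _; rewrite ?starM ?starK.
move: nexc; rewrite -eq_acb eqxx /= !negb_and negbK.
rewrite -eq_acb in E3 E5; case/or3P=> [neq | neq | cdT].
- apply: (starbZ a); apply/in_centerTP=> z.
  by have := E3 z; case: cg a neq => [] [].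
- apply/in_centerTP=> y; have := E5 (starb d1 y); rewrite starb2.
  by move: neq sfix; case: d1 a => [] [] //= _ sfix;
     rewrite ?starM ?starK sfix.
apply/in_centerTP=> z; have := E4 (starb d2 z).
by rewrite starb2 cdT.
Qed.

(** Here [s] acts on Gu as left multiplication conjugated by [starb a], and delta undoes the
    conjugation because [d1 = a]. Hence every element of G, not only a square, is left nuclear. *)
Lemma exceptional_left_nuclear_square :
    [&& a == cb, cg == cb, d1 == a & ~~ cd] ->
  left_nuclear_square_loop Q (Qone gT).
Proof.
case/and4P=> /eqP acb /eqP cgb /eqP d1a cdF.
split=> [|x y z]; first exact: Q_is_loop.
suff nuc s : Q (inl s) (Q y z) = Q (Q (inl s) y) z by case: x => x; apply: nuc.
move: cdF; rewrite /Q d1a cgb -acb; case: cd => // _.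
case: y z => y [] z /=; rewrite ?ffunE /= ?mulgA //; congr (_ _);
  by rewrite -?(g0C s); case: a; rewrite /= ?starM ?starK !mulgA.
Qed.

Lemma left_nuclear_square_LC :
    left_nuclear_square_loop Q (Qone gT) -> d2 = false -> cg = cd ->
  LC_loop Q (Qone gT).
Proof.
move=> LNS d2F cgd; apply/LC_loopP; split=> //.
have sfix := left_nuclear_square_starb LNS.
(* A swap in beta or delta rules out the exceptional triples: given [cg = cd], these have [cb] and
   [cd] both false. *)
have sqZ : cb || cd -> forall x : gT, x * x \in 'Z([set: gT]).
  move=> sw; apply: left_nuclear_square_central_squares LNS _.
  by rewrite cgd; case: cb cd sw => [] [] //; rewrite !andbF.
have sdZ : cb || cd -> forall x : gT, starb d1 x * x \in 'Z([set: gT]).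
  by case: d1 => // *; rewrite /= ?starC ?sqZ.
(* Up to [g0] this element is the square of xu; as [starb a] fixes it, beta multiplies by it
   unstarred. *)
have sdfix x : starb a (starb d1 x * x) = starb d1 x * x.
  by move: (sfix x); case: d1 a => [] [] //= _; rewrite starM starK.
have dC x : x * starb d1 x = starb d1 x * x by case: d1; rewrite /= ?starC.
rewrite /Q d2F cgd; case=> x [] y /=; rewrite ?ffunE /= ?mulgA //; congr (_ _).
- by case: a cb => [] []; rewrite /= ?starM !mulgA.
- rewrite -!mulgA; congr (_ * _); move: sdZ; case: cd => [sdZ|_] /=.
    have /in_centerTP sC := sdZ (orbT _) x.
    by rewrite dC sC -mulgA dC.
  by rewrite mulgA.
have -> : mulb cd (starb d1 x) x = starb d1 x * x by case: cd; rewrite /= ?dC.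
rewrite starbMl // sdfix; have -> : starb a g0 = g0 by case: a.
rewrite mulbMl //; move: sdZ; case: cb cd => [] [] /= sdZ;
  try have /in_centerTP sC := sdZ isT x.
- by rewrite !mulgA.
- by rewrite -sC -dC (mulgA x) -g0C !mulgA.
- by rewrite sC !mulgA.
by rewrite -dC (mulgA x) -g0C !mulgA.
Qed.

End Triple.

(** * Matching the codes with the lists of triples *)

Lemma left_nuclear_square_words (a cb cg d1 d2 cd : bool)
    (beta := bword a false cb) (gamma := bword false false cg)
    (delta := w_scale g0 (bword d1 d2 cd)) :
  left_nuclear_square_loop (Qmul beta gamma delta) (Qone gT) ->
  [\/ LC_loop (Qmul beta gamma delta) (Qone gT),
      (beta, gamma, delta) \in triples_b star g0,
      2.-abelem ([set: gT] / 'Z([set: gT])) /\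
        (beta, gamma, delta) \in triples_c star g0
    | [/\ 2.-abelem ([set: gT] / 'Z([set: gT])),
          forall x : gT, star (x * x) = x * x
        & (beta, gamma, delta) \in triples_d star g0]].
Proof.
rewrite {}/beta {}/gamma {}/delta => LNS.
(* This test settles 16 of the 64 codes. The other 48 split into 3 exceptional ones for (b), 21 more
   with [a = d1] for (c), and 24 with [a] different from [d1] for (d). *)
have [/andP[/negbTE d2F /eqP cgd] | nLC] := boolP (~~ d2 && (cg == cd)).
  by apply: Or41; apply: left_nuclear_square_LC.
have [exc | nexc] := boolP [&& a == cb, cg == cb, d1 == a & ~~ cd].
  apply: Or42; move: nLC exc {LNS}; rewrite /triples_b !bwordE.
  by case: a cb cg d1 d2 cd => [] [] [] [] [] [] // _ _;
    rewrite !in_cons !eqxx ?orbT.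
have sqZ := left_nuclear_square_central_squares _ _ _ _ _ _ LNS nexc.
have abel := abelem_center_quotient.2 sqZ.
have [ad | nad] := eqVneq a d1.
  apply: Or43; split=> //; move: nLC nexc ad {LNS sqZ}.
  rewrite /triples_c !bwordE.
  by case: a cb cg d1 d2 cd => [] [] [] [] [] [] // _ _ _;
    rewrite !in_cons !eqxx ?orbT.
apply: Or44; split=> //.
  have := left_nuclear_square_starb _ _ _ _ _ _ LNS.
  by rewrite -negb_eqb eq_sym nad.
move: nLC nad {LNS nexc sqZ}; rewrite /triples_d !bwordE.
by case: a cb cg d1 d2 cd => [] [] [] [] [] [] // _ _;
  rewrite !in_cons !eqxx ?orbT.
Qed.

Lemma triples_left_nuclear_square (beta gamma delta : word gT) :
  [\/ (beta, gamma, delta) \in triples_b star g0,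
      2.-abelem ([set: gT] / 'Z([set: gT])) /\
        (beta, gamma, delta) \in triples_c star g0
    | [/\ 2.-abelem ([set: gT] / 'Z([set: gT])),
          forall x : gT, star (x * x) = x * x
        & (beta, gamma, delta) \in triples_d star g0]] ->
  left_nuclear_square_loop (Qmul beta gamma delta) (Qone gT).
Proof.
case.
- rewrite /triples_b !bwordE.
  by repeat (case/predU1P=> [[-> -> ->] |];
             first exact: exceptional_left_nuclear_square).
- case=> /abelem_center_quotient sqZ; rewrite /triples_c !bwordE.
  by repeat (case/predU1P=> [[-> -> ->] |]; first
     by apply: left_nuclear_square_of_central_squares => //; left).
case=> /abelem_center_quotient sqZ sqfix; rewrite /triples_d !bwordE.
by repeat (case/predU1P=> [[-> -> ->] |]; first
   by apply: left_nuclear_square_of_central_squares => //; right).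
Qed.

End LoopsOfWords.

Theorem theorem8p12 (gT : finGroupType) (star : gT -> gT) (g0 : gT)
    (beta gamma delta : word gT)
    (star_anti : involutory_antiautomorphism star)
    (star_nonid : exists g : gT, star g <> g)
    (star_norm : forall g : gT, g * star g \in 'Z([set: gT]))
    (g0_center : g0 \in 'Z([set: gT]))
    (g0_star : star g0 = g0)
    (beta_in : beta \in beta_words star)
    (gamma_in : gamma \in gamma_words gT)
    (delta_in : delta \in delta_words star g0) :
  left_nuclear_square_loop (Qmul beta gamma delta) (Qone gT) <->
  [\/ LC_loop (Qmul beta gamma delta) (Qone gT),
      (beta, gamma, delta) \in triples_b star g0,
      2.-abelem ([set: gT] / 'Z([set: gT])) /\
        (beta, gamma, delta) \in triples_c star g0
    | [/\ 2.-abelem ([set: gT] / 'Z([set: gT])),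
          forall x : gT, star (x * x) = x * x
        & (beta, gamma, delta) \in triples_d star g0]].
Proof.
(* Words that coincide as functions have several codes; any choice will do, since the lemmas hold
   for every code. *)
have [a [cb defb]] := beta_wordsP _ _ _ beta_in.
have [cg defg] := gamma_wordsP _ star _ gamma_in.
have [d1 [d2 [cd defd]]] := delta_wordsP _ _ _ _ delta_in.
have listed := triples_left_nuclear_square _ _ _ star_anti star_norm g0_center
  g0_star beta gamma delta.
split=> [LNS | [LC | Hb | Hc | Hd]].
- by move: LNS; rewrite defb defg defd; apply: left_nuclear_square_words.
- by move: LC; rewrite defb defg defd => /LC_loopP[].
- by apply: listed; apply: Or31.
- by apply: listed; apply: Or32.
by apply: listed; apply: Or33.
Qed.
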